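(* Let $a$ be a positive integer and $b$ be a prime number greater than $a$. Then, for any integer $n\geq b+1$, we have \[L_{a,b,n}\leq \left(c_2\cdot b^{\frac{b}{b-1}}\right)^n,\] where $c_2=12.30641$.
   Context: For positive integers $a,b$ and a natural number $n$, $L_{a,b,n}:=\mathrm{lcm}(a,a+b,a+2b,\dots,a+nb)$. *)

(* Defs.v *)
From mathcomp Require Import all_boot all_order all_algebra.
From mathcomp Require Import reals.

Set Implicit Arguments.
Unset Strict Implicit.
Unset Printing Implicit Defensive.

Import GRing.Theory Num.Theory.
Local Open Scope ring_scope.

Definition lcm_progression (a b n : nat) : nat :=
  \big[lcmn/1%N]_(i < n.+1) (a + i * b)%N.

(* The decimal 12.30641, split because numerals in ring_scope are unary. *)
Definition c2 (R : realType) : R := 12 + 306 / 10 ^+ 3 + 41 / 10 ^+ 5.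

(* Main.v *)
Require Import Defs.
From mathcomp Require Import all_boot all_order all_algebra.
From mathcomp Require Import reals exp.
From mathcomp Require Import zify ring lra.
Import Order.TTheory GRing.Theory Num.Theory.
Local Open Scope ring_scope.

Set Implicit Arguments.
Unset Strict Implicit.

(** Write m = n + 1, L = lcm(a, a + b, ..., a + nb), P for the product of these
    m terms, D = lcm(1, ..., m), and v for the exponent of b in m!.  For a prime
    p not dividing b and q a power of p, at least [m / q] of the m terms are
    divisible by q, because any q consecutive terms contain one such multiple.
    The exponent of p in L counts the powers q that divide some term, and the
    exponent in P counts all pairs (q, term divisible by q); hence P / L
    contains p at least as often as m! / D does, D accounting for the one
    multiple of each q <= m that survives in the lcm.  As b itself is prime to L
    and b <= m, so that b divides D, comparing exponents prime by prime gives

      L * m! * b  divides  P * D * b^v                  [lcm_progression_dvdn].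

    Since a < b the i-th term is at most b (i + 1), so P <= b^m m!, and
    cancelling leaves L <= b^(n + v) D.  Legendre's formula gives
    v (b - 1) <= m - 1 = n [logn_fact_leq], whence b^(n + v) is at most
    (b^(b / (b - 1)))^n.

    It remains to see that D <= 4^n, which is below c2^n.  The binomial
    coefficient C(i + j, i) contains every prime p at least once for each power
    of p between max(i, j) + 1 and i + j, so lcm(1, ..., i + j) divides
    C(i + j, i) lcm(1, ..., max(i, j)) [lcm_upto_add_dvdn]; cutting m into two
    halves yields the bound by induction [lcm_upto_leq]. *)

(** * Exponents of primes as counts of prime powers *)

Lemma sum_nat_extend0 (F : nat -> nat) (n K : nat) :
  (n <= K)%N -> (forall e, (n <= e)%N -> F e = 0%N) ->
  (\sum_(1 <= e < n) F e = \sum_(1 <= e < K) F e)%N.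
Proof.
move=> nK F0; case: n nK F0 => [|n] nK F0.
  by rewrite big_geq // big1 // => e _; apply: F0.
rewrite [RHS](big_cat_nat _ nK) //= [X in (_ + X)%N]big_nat_cond.
by rewrite [X in (_ + X)%N]big1 ?addn0 // => e /andP[/andP[ne _] _]; apply: F0.
Qed.

(** Versions of [logn_count_dvd] and [logn_fact] with a free upper bound on the
    exponents, so that the exponents of several numbers can be compared term by
    term in sums over a common range. *)
Lemma logn_count_dvd_bound (p x K : nat) : prime p -> (0 < x <= K)%N ->
  logn p x = (\sum_(1 <= e < K) (p ^ e %| x))%N.
Proof.
move=> pp /andP[x0 xK]; rewrite logn_count_dvd //.
apply: sum_nat_extend0 => // e xe.
rewrite gtnNdvd //; exact: leq_ltn_trans xe (ltn_expl _ (prime_gt1 pp)).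
Qed.

Lemma logn_fact_bound (p m K : nat) : prime p -> (m < K)%N ->
  logn p m`! = (\sum_(1 <= e < K) m %/ p ^ e)%N.
Proof.
move=> pp mK; rewrite logn_fact //.
apply: sum_nat_extend0 => // e me.
by rewrite divn_small // (ltn_trans me) // ltn_expl // prime_gt1.
Qed.

Lemma logn_prod_ord (p m : nat) (x : nat -> nat) : (forall i, 0 < x i)%N ->
  logn p (\prod_(i < m) x i) = (\sum_(i < m) logn p (x i))%N.
Proof.
move=> x0; elim: m => [|m IHm]; first by rewrite !big_ord0 logn1.
by rewrite !big_ord_recr /= lognM ?IHm // prodn_gt0.
Qed.

Lemma dvdn_logn (x y : nat) : (0 < x)%N -> (0 < y)%N ->
  (forall p, prime p -> logn p x <= logn p y)%N -> (x %| y)%N.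
Proof.
move=> x0 y0 le_xy; apply/dvdn_partP => // p; rewrite mem_primes => /andP[pp _].
by rewrite p_part pfactor_dvdn // le_xy.
Qed.

Lemma biglcmn_gt0 (m : nat) (x : nat -> nat) : (forall i, 0 < x i)%N ->
  (0 < \big[lcmn/1%N]_(i < m) x i)%N.
Proof. by move=> x0; elim/big_ind: _ => // u v; rewrite lcmn_gt0 => -> ->. Qed.

Lemma pfactor_dvdn_biglcm (p e m : nat) (x : nat -> nat) :
  prime p -> (0 < e)%N -> (forall i, 0 < x i)%N ->
  (p ^ e %| \big[lcmn/1%N]_(i < m) x i)%N ->
  exists2 i, (i < m)%N & (p ^ e %| x i)%N.
Proof.
move=> pp e0 x0; elim: m => [|m IHm].
  by rewrite big_ord0 gtnNdvd // -(exp1n e) ltn_exp2r ?prime_gt1.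
rewrite big_ord_recr /=.
have L0 := biglcmn_gt0 m x0.
rewrite pfactor_dvdn ?lcmn_gt0 ?L0 ?x0 // logn_lcm // leq_max.
rewrite -!pfactor_dvdn //; case/orP => [/IHm[i im qi]|qm].
  by exists i => //; apply: ltnW.
by exists m.
Qed.

(** * The least common multiple of 1, ..., m *)

Definition lcm_upto (m : nat) : nat := \big[lcmn/1%N]_(i < m) i.+1.

Lemma lcm_upto_gt0 (m : nat) : (0 < lcm_upto m)%N.
Proof. exact: (@biglcmn_gt0 m succn). Qed.

Lemma dvdn_lcm_upto (k m : nat) : (0 < k <= m)%N -> (k %| lcm_upto m)%N.
Proof.
case: k => // k /= km.
exact: (dvdn_biglcmP _ _ _ (dvdnn _) (Ordinal km)).
Qed.

Lemma pfactor_dvdn_lcm_upto (p e m : nat) : prime p -> (0 < e)%N ->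
  (p ^ e %| lcm_upto m)%N = (p ^ e <= m)%N.
Proof.
move=> pp e0; apply/idP/idP => [/(@pfactor_dvdn_biglcm p e m succn pp e0)|qm].
  by case=> // i im /dvdn_leq qi; apply: leq_trans (qi _) im.
by apply: dvdn_lcm_upto; rewrite expn_gt0 prime_gt0.
Qed.

(** For a prime power q > max(i, j) with q <= i + j, the multiples of q give one
    more to (i + j)! than to i! j!; for q <= max(i, j) both least common
    multiples are divisible by q. *)
Lemma lcm_upto_add_dvdn (i j : nat) :
  (lcm_upto (i + j) %| 'C(i + j, i) * lcm_upto (maxn i j))%N.
Proof.
have fC : ('C(i + j, i) * (i`! * j`!) = (i + j)`!)%N.
  by rewrite -[in j`!](addKn i j) bin_fact ?leq_addr.
have f0 : (0 < i`! * j`!)%N by rewrite muln_gt0 !fact_gt0.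
rewrite -(dvdn_pmul2r f0) mulnAC fC.
have D0 := lcm_upto_gt0.
apply: dvdn_logn => [||p pp]; rewrite ?muln_gt0 ?D0 ?fact_gt0 //.
rewrite !lognM ?muln_gt0 ?D0 ?fact_gt0 //.
pose K := (lcm_upto (i + j) + lcm_upto (maxn i j) + i + j).+1.
have [Kij Ki Kj] : [/\ i + j < K, i < K & j < K]%N by rewrite /K; split; lia.
have KD k : (lcm_upto k <= K)%N ->
    logn p (lcm_upto k) = (\sum_(1 <= e < K) (p ^ e %| lcm_upto k))%N.
  by move=> kK; rewrite -logn_count_dvd_bound ?D0.
rewrite (logn_fact_bound pp Kij) (logn_fact_bound pp Ki) (logn_fact_bound pp Kj).
rewrite !KD; [|by rewrite /K; lia..].
rewrite -!big_split /= big_nat_cond [leqRHS]big_nat_cond.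
apply: leq_sum => e /andP[/andP[e0 _] _].
rewrite !pfactor_dvdn_lcm_upto //.
have q0 : (0 < p ^ e)%N by rewrite expn_gt0 prime_gt0.
move: (p ^ e)%N q0 => q q0.
case: (leqP q (maxn i j)) => [_|].
  by rewrite addnC leq_add ?leq_b1 // (divnD _ _ q0) leq_addr.
rewrite gtn_max => /andP[iq jq]; rewrite (divn_small iq) (divn_small jq) !addn0.
by case: (leqP q (i + j)) => //; rewrite -divn_gt0.
Qed.

(** The exponent m, one below the trivial 2^(m + 1), is what makes the induction
    in [lcm_upto_leq] close with the constant 4. *)
Lemma bin_leq_exp2 (m k : nat) : ('C(m.+1, k) <= 2 ^ m)%N.
Proof.
elim: m k => [|m IHm] [|k]; rewrite ?bin0 ?expn_gt0 //; first by case: k => [|[|k]].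
by rewrite binS expnS mul2n -addnn leq_add.
Qed.

(** Halving m + 1 costs a factor 2^m, by the bound on binomial coefficients, and
    leaves the half m / 2 + 1, to which the induction hypothesis contributes
    4^(m / 2) <= 2^m. *)
Lemma lcm_upto_leq (m : nat) : (lcm_upto m.+1 <= 4 ^ m)%N.
Proof.
elim/ltn_ind: m => m IHm; case: (posnP m) => [->|m0].
  by rewrite /lcm_upto big_ord1.
have hm : (m./2 < m)%N by lia.
have eD : (m.+1 = uphalf m + (m./2).+1)%N by lia.
have mx : maxn (uphalf m) (m./2).+1 = (m./2).+1 by lia.
have := lcm_upto_add_dvdn (uphalf m) (m./2).+1.
rewrite -eD mx => /dvdn_leq; rewrite muln_gt0 lcm_upto_gt0 bin_gt0.
have -> : (uphalf m <= m.+1)%N by lia.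
move=> /(_ isT) /leq_trans; apply.
have -> : (4 ^ m = 2 ^ m * 2 ^ m)%N by rewrite -expnMn.
apply: leq_mul; first exact: bin_leq_exp2.
apply: leq_trans (IHm _ hm) _.
by rewrite -(expnM 2 2) leq_exp2l //; lia.
Qed.

(** * The exponent of a prime in a factorial *)

(** Each quotient satisfies (p - 1) (x / p) <= x - x / p, and the sum
    telescopes; x - 1 rather than x is reached because the last nonzero quotient
    is at least 1. *)
Lemma logn_fact_leq (p m : nat) : prime p -> (logn p (m.+1)`! * p.-1 <= m)%N.
Proof.
move=> pp; rewrite logn_fact //; have p0 := prime_gt0 pp.
suff S K x : ((\sum_(1 <= e < K.+1) x.+1 %/ p ^ e) * p.-1 <= x)%N by exact: S.
elim: K x => [|K IHK] x; first by rewrite big_geq.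
rewrite big_nat_recl // big_add1 /= expn1.
under eq_bigr => e _ do rewrite expnS divnMA.
have := leq_divM x.+1 p.
case: (x.+1 %/ p)%N => [|y] yx.
  by rewrite big1 ?mul0n // => e _; rewrite div0n.
have := IHK y; rewrite big_add1 /=.
set s := (\sum_(_ <= _ < _) _)%N => Hs.
nia.
Qed.

(** * Comparing the progression with the factorial *)

(** With c such that q divides 1 + c b, every x satisfies q | x + (c x) b; this
    is used for x = a + m b, with c x reduced modulo q. *)
Lemma dvdn_progression_window (a b q m : nat) : (0 < q)%N -> coprime q b ->
  exists2 i, (m <= i < m + q)%N & (q %| a + i * b)%N.
Proof.
move=> q0 /eqP cqb; have [c _] := Bezoutl b q0; rewrite cqb => qc.
pose x := (a + m * b)%N.
exists (m + (c * x) %% q)%N; first by rewrite leq_addr ltn_add2l ltn_mod.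
rewrite mulnDl addnA -/x /dvdn -modnDmr modnMml modnDmr -/(dvdn _ _).
have -> : (x + c * x * b = (1 + c * b) * x)%N by ring.
exact: dvdn_mulr.
Qed.

Lemma count_dvdn_progression (a b q m : nat) : (0 < q)%N -> coprime q b ->
  (m %/ q <= \sum_(i < m) (q %| a + i * b))%N.
Proof.
move=> q0 cqb; rewrite -(big_mkord xpredT (fun i => (q %| a + i * b)%N : nat)).
rewrite (big_cat_nat (leq0n (m %/ q * q)) (leq_divM _ _)) /=.
apply: leq_trans (leq_addr _ _).
elim: (m %/ q)%N => // k IHk.
have [i /andP[ki ik] qi] := dvdn_progression_window a (k * q) q0 cqb.
rewrite (big_cat_nat (leq0n (k * q))) /=; last by rewrite leq_mul2r leqnSn orbT.
rewrite -addn1 leq_add //.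
rewrite (bigD1_seq i) ?iota_uniq ?mem_index_iota ?ki ?mulnDl ?mul1n //=.
by rewrite qi.
Qed.

(** The comparison of exponents at a prime p other than b, one power q = p^e at
    a time.  With m = n + 1: if q <= m, the [m / q] multiples of q among the terms
    balance the factorial and lcm(1, ..., m) balances the lcm of the terms; if
    q > m, the factorial contributes nothing, and q divides the lcm of the terms
    only if it divides some term. *)
Lemma dvdn_lcm_progression_count (a b n p e : nat) :
  (0 < a)%N -> prime p -> (0 < e)%N -> coprime p b ->
  ((p ^ e %| lcm_progression a b n) + n.+1 %/ p ^ e <=
   \sum_(i < n.+1) (p ^ e %| a + i * b) + (p ^ e %| lcm_upto n.+1))%N.
Proof.
move=> a0 pp e0 cpb; rewrite pfactor_dvdn_lcm_upto //.
have q0 : (0 < p ^ e)%N by rewrite expn_gt0 prime_gt0.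
have cqb : coprime (p ^ e) b by rewrite coprimeXl.
have term_gt0 i : (0 < a + i * b)%N by rewrite addn_gt0 a0.
case: (leqP (p ^ e) n.+1) => [_|mq].
  by rewrite addnC leq_add ?count_dvdn_progression ?leq_b1.
rewrite divn_small // !addn0.
case qL: (_ %| lcm_progression a b n)%N => //.
have [i im qi] := @pfactor_dvdn_biglcm p e n.+1 (fun i => a + i * b)%N pp e0 term_gt0 qL.
by rewrite (bigD1 (Ordinal im)) //= qi.
Qed.

(** The factor b on the left, available because b <= n + 1 divides the least
    common multiple on the right, is what later absorbs the surplus factor b in
    P <= b^(n + 1) (n + 1)!. *)
Lemma lcm_progression_dvdn (a b n : nat) :
  (0 < a)%N -> prime b -> (a < b)%N -> (b <= n.+1)%N ->
  (lcm_progression a b n * (n.+1)`! * b %|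
   (\prod_(i < n.+1) (a + i * b)) * lcm_upto n.+1 * b ^ logn b (n.+1)`!)%N.
Proof.
move=> a0 pb ab bm; have b0 := prime_gt0 pb.
have term_gt0 i : (0 < a + i * b)%N by rewrite addn_gt0 a0.
set P := (\prod_(i < n.+1) _)%N.
have P0 : (0 < P)%N by rewrite prodn_gt0.
have D0 := lcm_upto_gt0 n.+1.
have L0 : (0 < lcm_progression a b n)%N := biglcmn_gt0 n.+1 term_gt0.
have := fact_gt0 n.+1; move fE: (n.+1)`! => f f0.
apply: dvdn_logn => [||p pp]; rewrite ?(muln_gt0, expn_gt0) ?P0 ?D0 ?L0 ?f0 ?b0 //.
rewrite !lognM ?(muln_gt0, expn_gt0) ?P0 ?D0 ?L0 ?f0 ?b0 // lognX.
have [->|neq_pb] := eqVneq p b.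
  have -> : logn b (lcm_progression a b n) = 0%N.
    apply/eqP; rewrite eqn0Ngt -pfactor_dvdn //; apply/negP.
    move=> /(@pfactor_dvdn_biglcm b 1 n.+1 (fun i => a + i * b)%N pb isT term_gt0).
    by case=> i _; rewrite expn1 dvdn_addl ?dvdn_mull // gtnNdvd.
  have : (b ^ 1 %| lcm_upto n.+1)%N by rewrite pfactor_dvdn_lcm_upto.
  rewrite pfactor_dvdn // (logn_prime _ pb) eqxx muln1 add0n.
  by lia.
have cpb : coprime p b by rewrite prime_coprime // dvdn_prime2.
rewrite (logn_prime _ pb) (negPf neq_pb) muln0 !addn0.
rewrite (@logn_prod_ord p n.+1 (fun i => a + i * b)%N) // -fE.
pose K := (lcm_progression a b n + lcm_upto n.+1 + n.+2 + (a + n.+1 * b))%N.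
have [KL KD Km] : [/\ lcm_progression a b n <= K, lcm_upto n.+1 <= K & n.+1 < K]%N.
  by rewrite /K; split; lia.
rewrite (logn_fact_bound pp Km) (@logn_count_dvd_bound p (lcm_upto _) K) ?D0 //.
rewrite (@logn_count_dvd_bound p (lcm_progression _ _ _) K) ?L0 //.
have -> : (\sum_(i < n.+1) logn p (a + i * b) =
    \sum_(1 <= e < K) \sum_(i < n.+1) (p ^ e %| a + i * b))%N.
  rewrite exchange_big; apply: eq_bigr => i _; apply: logn_count_dvd_bound => //.
  rewrite term_gt0 (leq_trans _ (leq_addl _ _)) //.
  by rewrite leq_add2l leq_mul2r ltnW ?orbT.
rewrite -!big_split /= big_nat_cond [leqRHS]big_nat_cond.
apply: leq_sum => e /andP[/andP[e0 _] _].
exact: dvdn_lcm_progression_count.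
Qed.

Lemma prod_progression_leq (a b m : nat) : (a <= b)%N ->
  (\prod_(i < m) (a + i * b) <= b ^ m * m`!)%N.
Proof.
move=> ab; elim: m => [|m IHm]; first by rewrite big_ord0.
rewrite big_ord_recr /= expnSr factS.
have -> : (b ^ m * b * (m.+1 * m`!) = b ^ m * m`! * (m.+1 * b))%N by ring.
by rewrite leq_mul // mulSn leq_add2r.
Qed.

Lemma lcm_progression_leq (a b n : nat) :
  (0 < a)%N -> prime b -> (a < b)%N -> (b <= n.+1)%N ->
  (lcm_progression a b n <= 4 ^ n * b ^ (n + logn b (n.+1)`!))%N.
Proof.
move=> a0 pb ab bm; have b0 := prime_gt0 pb.
have := lcm_progression_dvdn a0 pb ab bm.
move/dvdn_leq; rewrite !muln_gt0 lcm_upto_gt0 expn_gt0 b0 prodn_gt0; last first.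
  by move=> i; rewrite addn_gt0 a0.
move=> /(_ isT) le_L.
have fb0 : (0 < (n.+1)`! * b)%N by rewrite muln_gt0 fact_gt0.
rewrite -(leq_pmul2r fb0) mulnA (leq_trans le_L) //.
have -> : (4 ^ n * b ^ (n + logn b (n.+1)`!) * ((n.+1)`! * b) =
    b ^ n.+1 * (n.+1)`! * 4 ^ n * b ^ logn b (n.+1)`!)%N.
  by rewrite expnD expnS; ring.
by rewrite !leq_mul ?prod_progression_leq ?lcm_upto_leq // ltnW.
Qed.

(** * The real bound *)

Theorem theorem1p2 (R : realType) (a b n : nat)
    (a_gt0 : (0 < a)%N) (b_prime : prime b) (a_lt_b : (a < b)%N)
    (n_ge : (b + 1 <= n)%N) :
  (lcm_progression a b n)%:R
    <= (c2 R * (b%:R `^ (b%:R / (b%:R - 1)))) ^+ n.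
Proof.
have b1 := prime_gt1 b_prime.
have bm : (b <= n.+1)%N by lia.
have b1R : 1 < b%:R :> R by rewrite ltr1n.
have le_L := lcm_progression_leq a_gt0 b_prime a_lt_b bm.
have Hv := logn_fact_leq n b_prime.
set v := logn b _ in le_L Hv.
apply: (@le_trans _ _ (4 ^ n * b ^ (n + v))%:R); first by rewrite ler_nat.
rewrite natrM !natrX exprMn ler_pM ?exprn_ge0 //.
  by rewrite lerXn2r ?nnegrE /c2; lra.
rewrite -!powR_mulrn ?powR_ge0 // -powRrM ler_powR ?(ltW b1R) //.
rewrite mulrAC ler_pdivlMr ?subr_gt0 //.
have : (v * b.-1)%:R <= n%:R :> R by rewrite ler_nat.
by rewrite natrM -subn1 natrB ?prime_gt0 // natrD; nra.
Qed.
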